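(* Let $n+1$ be even, $n=2m+1$ with $m\ge0$ an integer, and let $k\ge 0$ be an integer with $k+m\ge1$. For paravectors $x=x_0+\underline{x}$ and $y=y_0+\underline{y}$ in $\mathbb{R}^{n+1}\subset\mathbb{R}_n$, $$(\Delta_{y,n+1}\Delta_{x,n+1})^m\left[\left((xy^c)^{k+2m}\right)_0\right]=\frac12\,\widehat\beta_k^m\,Z_k^m(x,y),$$ where $$\widehat\beta_k^m=(-1)^m\,\frac{4^{2m}\,(k+2m)\,\Gamma(m+1)^3\,\Gamma(k+2m+1)}{(k+m)\,\Gamma(k+m+1)}.$$
   Context: $\mathbb{R}_n$ is the real Clifford algebra generated by $e_1,\dots,e_n$ with $e_je_k+e_ke_j=-2\delta_{jk}$, with basis $e_A=e_{a_1}\cdots e_{a_p}$, $A=\{a_1<\dots<a_p\}$. For $a=\sum_A a_Ae_A$, $(a)_0=a_\emptyset$ is its real part. Paravectors are elements $x=x_0+\underline{x}$ with $x_0\in\mathbb{R}$, $\underline{x}=\sum_{j=1}^n x_je_j$; they are identified with $\mathbb{R}^{n+1}$. The Clifford conjugate of a paravector is $y^c=y_0-\underline{y}$. Products and powers are taken in $\mathbb{R}_n$. $\Delta_{x,n+1},\Delta_{y,n+1}$ are the Euclidean Laplacians of $\mathbb{R}^{n+1}$ in $x$ and in $y$. Gegenbauer polynomials: $C_k^\lambda(z)=\sum_{j=0}^{\lfloor k/2\rfloor}(-1)^j\frac{\Gamma(k-j+\lambda)}{\Gamma(\lambda)\,j!\,(k-2j)!}(2z)^{k-2j}$. With $w=\frac{\langle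 x,y\rangle}{|x||y|}$, for $m\geq 1$ the zonal harmonic of $\mathbb{R}^{2m+2}$ is $Z_k^m(x,y)=\frac{k+m}{m}C_k^m(w)(|x||y|)^k$, and $Z_k^0(x,y)=2T_k(w)(|x||y|)^k$ for $k\ge1$ with $T_k$ the Chebyshev polynomial of the first kind (these are polynomial functions of $x,y$). *)

(* Defs.v *)
From HB Require Import structures.
From mathcomp Require Import all_boot all_order all_algebra.

Set Implicit Arguments.
Unset Strict Implicit.
Unset Printing Implicit Defensive.

Import Order.TTheory GRing.Theory Num.Theory.

Local Open Scope ring_scope.

(* An element is the family of its coordinates on the basis (e_A)_A, where A
   ranges over the subsets of 'I_n.  The constant clifford has its own
   ring instance: its product is cmul below, not the pointwise product of
   {ffun _ -> R}. *)
Definition clifford (R : comNzRingType) (n : nat) : Type :=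
  {ffun {set 'I_n} -> R}.

Section Clifford.
Variables (R : comNzRingType) (n : nat).

HB.instance Definition _ := GRing.Lmodule.copy (clifford R n)
  ({ffun {set 'I_n} -> R^o} : lmodType R).

Definition cblade (A : {set 'I_n}) : clifford R n := [ffun B => (B == A)%:R].

Definition symdiff (A B : {set 'I_n}) : {set 'I_n} :=
  (A :\: B) :|: (B :\: A).

(* e_A e_B = csign A B e_(A symdiff B): sorting the factors of e_A e_B exchanges
   e_i and e_j once for each i in A and j in B with j < i, and each i common to
   A and B contributes e_i ^ 2 = -1. *)
Definition csign (A B : {set 'I_n}) : R :=
  \prod_(i in A) \prod_(j in B | (j <= i)%N) -1.

Definition cmul (a b : clifford R n) : clifford R n :=
  \sum_A \sum_B (csign A B * (a A * b B)) *: cblade (symdiff A B).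

Lemma in_symdiff A B i : (i \in symdiff A B) = (i \in A) (+) (i \in B).
Proof. by rewrite !inE; do 2!case: (_ \in _). Qed.

Lemma symdiffA : associative symdiff.
Proof. by move=> A B C; apply/setP => i; rewrite !in_symdiff addbA. Qed.

Lemma symdiff0 A : symdiff A set0 = A.
Proof. by apply/setP => i; rewrite in_symdiff inE addbF. Qed.

Lemma sym0diff A : symdiff set0 A = A.
Proof. by apply/setP => i; rewrite in_symdiff inE. Qed.

Lemma csignE A B : csign A B =
  \prod_i \prod_j (-1) ^+ [&& i \in A, j \in B & (j <= i)%N].
Proof.
rewrite /csign big_mkcond; apply: eq_bigr => i _.
case: (i \in A); last by rewrite big1.
by rewrite big_mkcond; apply: eq_bigr => j _; case: ifP.
Qed.

Lemma csign_symdiffl A B C : csign (symdiff A B) C = csign A C * csign B C.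
Proof.
rewrite !csignE -big_split; apply: eq_bigr => i _ /=.
rewrite -big_split; apply: eq_bigr => j _ /=.
rewrite in_symdiff -signr_addb.
by case: (i \in A); case: (i \in B); case: (j \in C); case: (j <= i)%N.
Qed.

Lemma csign_symdiffr A B C : csign A (symdiff B C) = csign A B * csign A C.
Proof.
rewrite !csignE -big_split; apply: eq_bigr => i _ /=.
rewrite -big_split; apply: eq_bigr => j _ /=.
rewrite in_symdiff -signr_addb.
by case: (i \in A); case: (j \in B); case: (j \in C); case: (j <= i)%N.
Qed.

Lemma csign0r A : csign A set0 = 1.
Proof. by rewrite /csign big1 // => i _; rewrite big1 // => j; rewrite inE. Qed.

Lemma csign0l A : csign set0 A = 1.
Proof. by rewrite /csign big1 // => i; rewrite inE. Qed.

Lemma cliffordE (a : clifford R n) : a = \sum_A a A *: cblade A.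
Proof.
apply/ffunP => B; rewrite sum_ffunE (bigD1 B) //= !ffunE eqxx /GRing.scale /= mulr1.
rewrite big1 ?addr0 // => A AB; rewrite !ffunE eq_sym (negPf AB).
by rewrite /GRing.scale /= mulr0.
Qed.

Lemma cmulDl : left_distributive cmul +%R.
Proof.
move=> a b c; rewrite /cmul -big_split; apply: eq_bigr => A _ /=.
rewrite -big_split; apply: eq_bigr => B _ /=.
by rewrite -scalerDl ffunE mulrDl mulrDr.
Qed.

Lemma cmulDr : right_distributive cmul +%R.
Proof.
move=> a b c; rewrite /cmul -big_split; apply: eq_bigr => A _ /=.
rewrite -big_split; apply: eq_bigr => B _ /=.
by rewrite -scalerDl ffunE !mulrDr.
Qed.

Lemma cscaleE k (a : clifford R n) A : (k *: a) A = k * a A.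
Proof. by rewrite ffunE. Qed.

Lemma cscaleAl k a b : k *: cmul a b = cmul (k *: a) b.
Proof.
rewrite /cmul scaler_sumr; apply: eq_bigr => A _.
rewrite scaler_sumr; apply: eq_bigr => B _.
by rewrite scalerA cscaleE -mulrA mulrCA.
Qed.

Lemma cscaleAr k a b : k *: cmul a b = cmul a (k *: b).
Proof.
rewrite /cmul scaler_sumr; apply: eq_bigr => A _.
rewrite scaler_sumr; apply: eq_bigr => B _.
by rewrite scalerA cscaleE mulrCA [a A * (k * b B)]mulrCA.
Qed.

Lemma cmul0l a : cmul 0 a = 0.
Proof. by have := cscaleAl 0 0 a; rewrite !scale0r => <-. Qed.

Lemma cmul0r a : cmul a 0 = 0.
Proof. by have := cscaleAr 0 a 0; rewrite !scale0r => <-. Qed.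

Lemma cmul_suml (I : finType) (F : I -> clifford R n) b :
  cmul (\sum_i F i) b = \sum_i cmul (F i) b.
Proof.
exact: (big_morph (cmul^~ b) (fun x y => cmulDl x y b) (cmul0l b)).
Qed.

Lemma cmul_sumr (I : finType) (F : I -> clifford R n) a :
  cmul a (\sum_i F i) = \sum_i cmul a (F i).
Proof.
exact: (big_morph (cmul a) (cmulDr a) (cmul0r a)).
Qed.

Lemma cmul_blade A B :
  cmul (cblade A) (cblade B) = csign A B *: cblade (symdiff A B).
Proof.
rewrite /cmul (bigD1 A) //= (bigD1 B) //= !ffunE !eqxx !mulr1.
rewrite [X in _ + X + _]big1 => [|C CB]; last first.
  by rewrite !ffunE (negPf CB) !mulr0 scale0r.
rewrite big1 ?addr0 // => C CA; rewrite big1 // => D _.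
by rewrite !ffunE (negPf CA) mul0r mulr0 scale0r.
Qed.

Lemma cmulA : associative cmul.
Proof.
have bladeA A B C : cmul (cblade A) (cmul (cblade B) (cblade C)) =
    cmul (cmul (cblade A) (cblade B)) (cblade C).
  rewrite !cmul_blade -cscaleAr -cscaleAl !cmul_blade !scalerA symdiffA.
  by rewrite csign_symdiffl csign_symdiffr mulrCA mulrA [_ * csign B C]mulrC mulrA.
pose e (a : clifford R n) A := a A *: cblade A.
have bladesA A B c : cmul (cblade A) (cmul (cblade B) c) =
    cmul (cmul (cblade A) (cblade B)) c.
  rewrite (cliffordE c) !(cmul_sumr (e c)) cmul_sumr; apply: eq_bigr => C _.
  by rewrite /e -!cscaleAr bladeA.
have bladeAA A b c : cmul (cblade A) (cmul b c) = cmul (cmul (cblade A) b) c.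
  rewrite (cliffordE b) (cmul_sumr (e b)) (cmul_suml (e b)) cmul_suml cmul_sumr.
  apply: eq_bigr => B _.
  by rewrite /e -cscaleAl -!cscaleAr -cscaleAl bladesA.
move=> a b c; rewrite (cliffordE a) !(cmul_suml (e a)) cmul_suml.
by apply: eq_bigr => A _; rewrite /e -!cscaleAl bladeAA.
Qed.

Lemma cmul1l : left_id (cblade set0) cmul.
Proof.
move=> a; rewrite [a in LHS]cliffordE [a in RHS]cliffordE cmul_sumr.
apply: eq_bigr => A _.
by rewrite -cscaleAr cmul_blade csign0l scale1r sym0diff.
Qed.

Lemma cmul1r : right_id (cblade set0) cmul.
Proof.
move=> a; rewrite [a in LHS]cliffordE [a in RHS]cliffordE cmul_suml.
apply: eq_bigr => A _.
by rewrite -cscaleAl cmul_blade csign0r scale1r symdiff0.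
Qed.

Lemma cblade_neq0 : cblade set0 != 0.
Proof.
by apply/eqP => /ffunP/(_ set0)/eqP; rewrite !ffunE eqxx oner_eq0.
Qed.

HB.instance Definition _ := GRing.Zmodule_isNzRing.Build (clifford R n)
  cmulA cmul1l cmul1r cmulDl cmulDr cblade_neq0.
HB.instance Definition _ :=
  GRing.Lmodule_isLalgebra.Build R (clifford R n) cscaleAl.
HB.instance Definition _ :=
  GRing.Lalgebra_isAlgebra.Build R (clifford R n) cscaleAr.

Definition cgen (j : 'I_n) : clifford R n := cblade [set j].

Definition creal (a : clifford R n) : R := a set0.

Lemma csign1 i j : csign [set i] [set j] = if (j <= i)%N then -1 else 1.
Proof.
by rewrite /csign big_set1 big_mkcondr big_set1.
Qed.

Lemma symdiff1C (i j : 'I_n) : symdiff [set i] [set j] = symdiff [set j] [set i].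
Proof. by apply/setP => k; rewrite !in_symdiff addbC. Qed.

Lemma cgen_anticomm j k :
  cgen j * cgen k + cgen k * cgen j = ((j == k)%:R * - 2%:R)%:A.
Proof.
rewrite [cgen j * _]cmul_blade [cgen k * _]cmul_blade symdiff1C -scalerDl !csign1.
have [->|jk] := eqVneq j k.
  rewrite leqnn mul1r -opprD.
  suff -> : symdiff [set k] [set k] = set0 by [].
  by apply/setP => i; rewrite in_symdiff addbb inE.
rewrite mul0r scale0r leqNgt ltn_neqAle -[_ == _ :> nat]/(j == k) jk /=.
by case: (j <= k)%N; rewrite /= ?subrr ?addNr scale0r.
Qed.

(* The factors are taken in increasing order of their indices. *)
Lemma cblade_prod (A : {set 'I_n}) : cblade A = \prod_(j in A) cgen j.
Proof.
rewrite -big_filter [index_enum _]unlock -/(enum A) -[in LHS](set_enum A).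
have : sorted (fun i j : 'I_n => (i < j)%N) (enum A).
  rewrite {1}/enum_mem -enumT; apply: sorted_filter.
    by move=> j i k; apply: ltn_trans.
  by rewrite -[sorted _ _]/(sorted (relpre val ltn) _) -sorted_map val_enum_ord iota_ltn_sorted.
elim: (enum A) => [|i s IHs] /= s_sorted.
  by rewrite big_nil; congr cblade; apply/setP => j; rewrite !inE.
have lt_is j : j \in s -> (i < j)%N.
  apply/allP: j; apply: order_path_min s_sorted => j k l; exact: ltn_trans.
rewrite big_cons -IHs ?(path_sorted s_sorted) // [RHS]cmul_blade.
have -> : csign [set i] [set j in s] = 1.
  rewrite /csign big_set1 big1 // => j /andP[]; rewrite inE => /lt_is.
  by rewrite ltnNge => /negPf ->.
rewrite scale1r; congr cblade; apply/setP => j; rewrite in_symdiff !inE.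
by have [->|//] := eqVneq j i; case: (boolP (i \in s)) => // /lt_is; rewrite ltnn.
Qed.

(* A paravector x_0 + x_1 e_1 + ... + x_n e_n is given by its coordinates
   (x_0, ..., x_n); cgen j is e_(j+1). *)
Definition paravector (x : 'rV[R]_n.+1) : clifford R n :=
  (x 0 0)%:A + \sum_(j < n) x 0 (lift ord0 j) *: cgen j.

Definition paravector_conj (x : 'rV[R]_n.+1) : clifford R n :=
  (x 0 0)%:A - \sum_(j < n) x 0 (lift ord0 j) *: cgen j.

End Clifford.

From mathcomp Require Import all_classical all_reals all_analysis.

Import numFieldNormedType.Exports.

Local Open Scope classical_set_scope.

Section Analysis.
Variable R : realType.

(* The norm that the library puts on 'rV[R]_d is the sup norm, hence the
   explicit Euclidean norm. *)
Definition inner d (x y : 'rV[R]_d) : R := \sum_(i < d) x 0 i * y 0 i.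

Definition enorm d (x : 'rV[R]_d) : R := Num.sqrt (inner x x).

Definition laplacian d (f : 'rV[R]_d -> R) (p : 'rV[R]_d) : R :=
  \sum_(i < d) 'D_(delta_mx 0 i) ('D_(delta_mx 0 i) f) p.

Definition laplacian_x d (F : 'rV[R]_d -> 'rV[R]_d -> R) :
  'rV[R]_d -> 'rV[R]_d -> R := fun x y => laplacian (fun x' => F x' y) x.

Definition laplacian_y d (F : 'rV[R]_d -> 'rV[R]_d -> R) :
  'rV[R]_d -> 'rV[R]_d -> R := fun x y => laplacian (fun y' => F x y') y.

Definition Gamma (s : R) : R :=
  \int[lebesgue_measure]_(t in `[0, +oo[) (t `^ (s - 1) * expR (- t)).

Definition gegenbauer (k : nat) (lambda z : R) : R :=
  \sum_(j < k./2.+1)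
    (-1) ^+ j * (Gamma ((k - j)%:R + lambda) /
      (Gamma lambda * j`!%:R * (k - 2 * j)`!%:R)) * (2 * z) ^+ (k - 2 * j).

Fixpoint chebyshevT (k : nat) : {poly R} :=
  match k with
  | 0 => 1
  | k'.+1 => match k' with
             | 0 => 'X
             | k''.+1 => 2 *: 'X * chebyshevT k' - chebyshevT k''
             end
  end.

(* When x = 0 or y = 0 the quotient is 0 by convention and the value is that of
   the polynomial extension: the factor (|x||y|)^k vanishes for k > 0, and
   C_0^m and T_0 are constant.  The value at m = k = 0 is not meaningful. *)
Definition zonal (m k d : nat) (x y : 'rV[R]_d) : R :=
  let r := enorm x * enorm y in
  let w := inner x y / r in
  if m == 0 then 2 * (chebyshevT k).[w] * r ^+ k
  else (k + m)%:R / m%:R * gegenbauer k m%:R w * r ^+ k.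

Definition betahat (m k : nat) : R :=
  (-1) ^+ m * (4 ^+ (2 * m) * (k + 2 * m)%:R * Gamma (m + 1)%:R ^+ 3
                * Gamma (k + 2 * m + 1)%:R)
  / ((k + m)%:R * Gamma (k + m + 1)%:R).

End Analysis.

(* Main.v *)
(** Write [s = <x, y>], [N = |x|^2 |y|^2] and [q = x y^c].  Since [q + y x^c = 2 s]
    and [q (y x^c) = N], the real parts of the powers of [q] satisfy the
    recurrence of the Chebyshev polynomials, so [(q^K)_0 = |x|^K |y|^K T_K(w)].
    On rotation invariant polynomials, i.e. on the span of the monomials
    [s^a |x|^(2b) |y|^(2c)], the two Laplacians commute, hence
    [(Delta_y Delta_x)^m = Delta_y^m Delta_x^m].  In dimension [2m+2], [Delta_x] maps
    the homogenized Gegenbauer polynomial [C_(k+2)^p] to a multiple of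
    [|y|^2 C_k^(p+1)], where [p = 0] stands for [T_(k+2)]; after [m] steps, [T_(k+2m)]
    has become a multiple of [|y|^(2m)] times the zonal harmonic [C_k^m], and
    [Delta_y^m] then removes the factor [|y|^(2m)]. *)

Require Import Defs.
From mathcomp Require Import all_boot all_order all_algebra.
From mathcomp Require Import all_classical all_reals all_analysis.
From mathcomp Require Import ring zify.
Import Order.TTheory GRing.Theory Num.Theory.
Import numFieldNormedType.Exports.
Local Open Scope ring_scope.

Set Implicit Arguments.
Unset Strict Implicit.
Unset Printing Implicit Defensive.

(** * The Gamma function at positive integers *)

Section Gamma.
Local Open Scope classical_set_scope.
Variable R : realType.

(* The polynomial [p] such that [- p(t) e^(-t)] is a primitive of [t^n e^(-t)]. *)
Fixpoint gamma_poly (n : nat) : {poly R} :=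
  if n is n'.+1 then 'X^n + gamma_poly n' *+ n else 1.

Lemma gamma_poly0 n : (gamma_poly n).[0] = n`!%:R.
Proof.
elim: n => [|n IHn] /=; first by rewrite hornerC.
by rewrite hornerD hornerXn hornerMn IHn expr0n /= add0r factS mulnC mulrnA.
Qed.

Lemma gamma_poly_deriv n : gamma_poly n - (gamma_poly n)^`() = 'X^n.
Proof.
elim: n => [|n IHn] /=; first by rewrite derivC subr0 expr0.
rewrite derivD derivXn derivMn -[_.+1.-1]/n -IHn.
by rewrite -mulrnDl subrK addrK.
Qed.

(** For [x > 0], the bound [e^x >= x^(n+1) / (n+1)!] squeezes the function between [0] and
    [(n+1)! / x]. *)
Lemma cvg_exprn_expRN n : x ^+ n * expR (- x) @[x --> +oo] --> (0 : R).
Proof.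
apply: (@squeeze_cvgr _ _ _ _ (cst 0) (fun x => n.+1`!%:R * x^-1)).
- near=> x.
  have x0 : 0 < x by near: x; exact: nbhs_pinfty_gt.
  apply/andP; split; first by rewrite mulr_ge0 ?exprn_ge0 ?expR_ge0 // ltW.
  rewrite expRN ler_pdivrMr ?expR_gt0 // mulrAC ler_pdivlMr // -exprSr.
  rewrite [leRHS]mulrC -ler_pdivrMr ?ltr0n ?fact_gt0 //.
  by apply: le_trans (expR_ge1Dxn n (ltW x0)); rewrite lerDr.
- exact: cvg_cst.
- rewrite -[X in _ --> X](mulr0 n.+1`!%:R).
  by apply: cvgMl_tmp; apply/gtr0_cvgV0; [near=> x|exact: cvg_id].
Unshelve. all: by end_near. Qed.

Lemma cvg_gamma_poly n : (gamma_poly n).[x] * expR (- x) @[x --> +oo] --> (0 : R).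
Proof.
elim: n => [|n IHn].
  under eq_fun => x do rewrite /= hornerC -[1](expr0 x).
  exact: cvg_exprn_expRN.
have -> : (fun x => (gamma_poly n.+1).[x] * expR (- x)) =
    (fun x => x ^+ n.+1 * expR (- x)) \+
    (fun x => n.+1%:R * ((gamma_poly n).[x] * expR (- x))).
  by apply/funext => x /=; rewrite hornerD hornerXn hornerMn; ring.
have := cvgD (cvg_exprn_expRN n.+1) (cvgMl_tmp (a := n.+1%:R) IHn).
by rewrite mulr0 addr0; apply.
Qed.

Lemma is_derive_gamma_poly n (x : R) :
  is_derive x 1 (fun t => - ((gamma_poly n).[t] * expR (- t)))
    (x ^+ n * expR (- x)).
Proof.
have e : is_derive x 1 (fun t : R => expR (- t)) (- expR (- x)).
  by apply: is_derive_eq; rewrite mulrN1.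
apply: (@is_derive_eq _ _ _ (- (horner (gamma_poly n) * (fun t => expR (- t))))).
rewrite /GRing.scale /=.
have /(congr1 (horner^~ x)) := gamma_poly_deriv n.
by rewrite !hornerE => <-; ring.
Qed.

Lemma GammaS n : Gamma n.+1%:R = n`!%:R :> R.
Proof.
pose F t : R := - ((gamma_poly n).[t] * expR (- t)).
have dF x : derivable F x 1 by exact: (@ex_derive _ _ _ _ _ _ _ (is_derive_gamma_poly n x)).
have cF x : {for x, continuous F} by exact/differentiable_continuous/derivable1_diffP.
rewrite /Gamma.
under eq_Rintegral => t.
  rewrite inE /= in_itv /= andbT => t0.
  rewrite -[n.+1%:R]natr1 addrK powR_mulrn //.
  over.
(* The primitive [F] tends to [0] at infinity and [F 0 = - n!]. *)
rewrite (@Rintegral_ge0_continuous_FTC2y _ _ F 0 0).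
- by rewrite /F gamma_poly0 oppr0 expR0 mulr1 sub0r opprK.
- by move=> x x0; rewrite mulr_ge0 ?exprn_ge0 ?expR_ge0.
- apply: continuous_subspaceT => x.
  apply: cvgM; first exact: exprn_continuous.
  by apply: continuous_comp; [exact: opp_continuous | exact: continuous_expR].
- by rewrite -oppr0; apply: cvgN; exact: cvg_gamma_poly.
- by move=> x _.
- exact/cvg_at_right_filter/cF.
- move=> x _; rewrite derive1E.
  exact: (@derive_val _ _ _ _ _ _ _ (is_derive_gamma_poly n x)).
Qed.

End Gamma.

(** * Real parts of powers of x y^c *)

Section Paravectors.
Variables (R : realType) (n : nat).
Implicit Types x y : 'rV[R]_n.+1.

Definition vecpart x : clifford R n := \sum_(j < n) x 0 (lift ord0 j) *: cgen R j.

Lemma scale_cgen_anticomm (a b : R) (i j : 'I_n) :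
  a *: cgen R i * (b *: cgen R j) + b *: cgen R j * (a *: cgen R i) =
  ((i == j)%:R * - (2 * (a * b)))%:A :> clifford R n.
Proof.
transitivity ((a * b) *: (cgen R i * cgen R j + cgen R j * cgen R i)).
  by rewrite scalerDr -!scalerAl -!scalerAr !scalerA [b * a]mulrC.
rewrite cgen_anticomm scalerA; congr (_ *: _).
by rewrite mulrCA mulrN [a * b * _]mulrC.
Qed.

(** The products with distinct indices cancel in pairs by anticommutation; only the squares
    [e_j^2 = -1] remain. *)
Lemma vecpart_anticomm x y : vecpart x * vecpart y + vecpart y * vecpart x =
  (- (2 * \sum_(j < n) x 0 (lift ord0 j) * y 0 (lift ord0 j)))%:A.
Proof.
rewrite /vecpart !mulr_suml.
under eq_bigr do rewrite mulr_sumr.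
under [X in _ + X]eq_bigr do rewrite mulr_sumr.
rewrite [X in _ + X]exchange_big -big_split /= mulr_sumr -sumrN scaler_suml.
apply: eq_bigr => i _; rewrite -big_split /= (bigD1 i) //= big1 => [|j ji].
  by rewrite addr0 scale_cgen_anticomm eqxx mul1r.
by rewrite scale_cgen_anticomm eq_sym (negPf ji) mul0r scale0r.
Qed.

Lemma paravectorM_conjD x y :
  paravector x * paravector_conj y + paravector y * paravector_conj x =
  (2 * inner x y)%:A.
Proof.
have -> : 2 * inner x y = x 0 0 * y 0 0 + x 0 0 * y 0 0 +
    2 * \sum_(j < n) x 0 (lift ord0 j) * y 0 (lift ord0 j).
  by rewrite /inner big_ord_recl; ring.
rewrite !scalerDl -[X in _ = _ + X]opprK -scaleNr -vecpart_anticomm.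
rewrite /paravector /paravector_conj -!/(vecpart _).
rewrite !mulrDl !mulrBr -!scalerAl -!scalerAr !mul1r !mulr1 !scalerA.
rewrite [y 0 0 * x 0 0]mulrC.
set A := _%:A; set B := _ *: vecpart y; set C := _ *: vecpart x.
rewrite addrACA [X in X + _]addrACA -[- B - C]opprD.
by rewrite (addrACA C) -opprD [C + B]addrC addrA subrK.
Qed.

Lemma paravectorM_conj x : paravector x * paravector_conj x = (inner x x)%:A.
Proof.
have two0 : 2 != 0 :> R by rewrite pnatr_eq0.
apply: (scalerI two0); rewrite scalerA -paravectorM_conjD.
by rewrite -[2]/(1 + 1) scalerDl !scale1r.
Qed.

(** Since [x^c = 2 x_0 - x] is a polynomial in [x], it commutes with [x]. *)
Lemma paravector_conjM x : paravector_conj x * paravector x = (inner x x)%:A.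
Proof.
have conjE : paravector_conj x = (2 * x 0 0)%:A - paravector x.
  by rewrite /paravector /paravector_conj mulr_natl mulr2n scalerDl opprD addrA addrK.
by rewrite -paravectorM_conj conjE mulrBl mulrBr mulr_algl mulr_algr.
Qed.

(** [q] is a root of [X^2 - 2 s X + N]: in the product [x y^c y x^c] the inner factor [y^c y] is a
    scalar and can be moved out. *)
Lemma paravector_quadratic x y (q := paravector x * paravector_conj y) :
  q ^+ 2 = (2 * inner x y) *: q - (inner x x * inner y y)%:A.
Proof.
have qq' : q * (paravector y * paravector_conj x) = (inner x x * inner y y)%:A.
  rewrite /q mulrA -[X in X * _]mulrA paravector_conjM.
  by rewrite mulr_algr -scalerAl paravectorM_conj scalerA mulrC.
rewrite -qq' -[_ *: q]mulr_algr -paravectorM_conjD -/q mulrDr addrK.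
by rewrite expr2.
Qed.

Lemma creal_paravectorS x y (q := paravector x * paravector_conj y) k :
  creal (q ^+ k.+2) = 2 * inner x y * creal (q ^+ k.+1)
    - inner x x * inner y y * creal (q ^+ k).
Proof.
rewrite -addn2 exprD paravector_quadratic -/q mulrBr -!scalerAr -exprSr mulr1.
by rewrite /creal !ffunE.
Qed.

(** The product [e_A e_B] has a real part only when [A = B], and these diagonal terms are symmetric
    in the two factors. *)
Lemma creal_mulC (a b : clifford R n) : creal (a * b) = creal (b * a).
Proof.
have E (u v : clifford R n) : creal (u * v) =
    \sum_A \sum_B csign R A B * (u A * v B) * (finset.set0 == symdiff A B)%:R.
  rewrite /creal [u * v]/(cmul u v) sum_ffunE; apply: eq_bigr => A _.
  by rewrite sum_ffunE; apply: eq_bigr => B _; rewrite !ffunE.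
rewrite !E exchange_big; apply: eq_bigr => A _; apply: eq_bigr => B _ /=.
have [<-|AB] := eqVneq A B; first by rewrite [a A * _]mulrC.
have symdiff_neq0 C D : C != D -> (finset.set0 == symdiff C D) = false.
  move=> CD; apply: contra_neqF CD => /eqP CD0; apply/setP => i.
  by have := in_symdiff C D i; rewrite -CD0 inE; case: (_ \in C); case: (_ \in D).
by rewrite !symdiff_neq0 ?mulr0 // eq_sym.
Qed.

Lemma creal_vecpart x : creal (vecpart x) = 0.
Proof.
rewrite /creal sum_ffunE big1 // => i _; rewrite !ffunE.
case: eqP => [/setP/(_ i)|_]; last exact: mulr0.
by rewrite !inE eqxx.
Qed.

Lemma crealD : {morph @creal R n : a b / a + b}.
Proof. by move=> a b; rewrite /creal ffunE. Qed.

Lemma crealN : {morph @creal R n : a / - a}.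
Proof. by move=> a; rewrite /creal ffunE. Qed.

Lemma crealZ k a : @creal R n (k *: a) = k * creal a.
Proof. exact: cscaleE. Qed.

Lemma creal1 : @creal R n 1 = 1.
Proof. by rewrite /creal ffunE eqxx. Qed.

Lemma creal_paravector1 x y :
  creal (paravector x * paravector_conj y) = inner x y.
Proof.
have two0 : 2 != 0 :> R by rewrite pnatr_eq0.
(* By the trace property, the real part of the anticommutator is twice the real part sought. *)
have uv : creal (vecpart x * vecpart y) =
    - \sum_(j < n) x 0 (lift ord0 j) * y 0 (lift ord0 j).
  apply: (mulfI two0); rewrite mulrN.
  have := congr1 (@creal R n) (vecpart_anticomm x y).
  by rewrite crealD crealZ creal1 mulr1 [X in _ + X]creal_mulC => <-; ring.
rewrite /paravector /paravector_conj -!/(vecpart _).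
rewrite mulrDl !mulrBr -!scalerAl -!scalerAr !mul1r !mulr1 scalerA.
rewrite !(crealD, crealN, crealZ) uv !creal_vecpart creal1 /inner big_ord_recl.
by rewrite /=; ring.
Qed.

End Paravectors.

(** * Laplacians of rotation invariant polynomials *)

(** [I] is the class on which [P] and [Q] are known to commute; its stability under both lets [P]
    pass through the iterates of [Q]. *)
Lemma iter_comp_commute (T : Type) (I : T -> Prop) (P Q : T -> T) :
  (forall F, I F -> I (P F)) -> (forall F, I F -> I (Q F)) ->
  (forall F, I F -> Q (P F) = P (Q F)) ->
  forall m F, I F -> iter m (fun G => Q (P G)) F = iter m Q (iter m P F).
Proof.
move=> IP IQ PQ m F IF.
have inv_P j G : I G -> I (iter j P G) by move=> IG; elim: j => //= j; exact: IP.
have inv_Q j G : I G -> I (iter j Q G) by move=> IG; elim: j => //= j; exact: IQ.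
have P_iterQ j G : I G -> P (iter j Q G) = iter j Q (P G).
  by move=> IG; elim: j => //= j IHj; rewrite -PQ ?IHj //; exact: inv_Q.
by elim: m => //= m ->; rewrite P_iterQ //; exact: inv_P.
Qed.

Section Laplacian.
Variables (R : realType) (d : nat).
Implicit Types p q v x y : 'rV[R]_d.
Local Notation V := 'rV[R]_d.

Lemma is_derive_mul (f g : V -> R) p v df dg :
  is_derive p v f df -> is_derive p v g dg ->
  is_derive p v (fun t => f t * g t) (f p * dg + g p * df).
Proof. exact: is_deriveM. Qed.

Lemma is_derive_pow (f : V -> R) n p v df : is_derive p v f df ->
  is_derive p v (fun t => f t ^+ n) (n%:R * f p ^+ n.-1 * df).
Proof.
have -> : (fun t => f t ^+ n) = f ^+ n by apply/funext => t; rewrite fctE.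
exact: is_deriveX.
Qed.

Lemma is_derive_scale (f : V -> R) c p v df : is_derive p v f df ->
  is_derive p v (fun t => c * f t) (c * df).
Proof. exact: is_deriveZ. Qed.

Lemma is_derive_add (f g : V -> R) p v df dg :
  is_derive p v f df -> is_derive p v g dg ->
  is_derive p v (fun t => f t + g t) (df + dg).
Proof. exact: is_deriveD. Qed.

Lemma is_derive_coord i p v : is_derive p v (fun x : V => x 0 i) (v 0 i).
Proof.
have /derivable_mxP dx := @derivable_id _ V p v.
apply: DeriveDef; first exact: dx.
have := derive_mx (@derivable_id _ V p v).
by rewrite derive_id => /matrixP/(_ 0 i); rewrite mxE.
Qed.

Lemma inner_delta (i : 'I_d) p : inner (delta_mx 0 i) p = p 0 i.
Proof.
rewrite /inner (bigD1 i) //= mxE !eqxx mul1r big1 ?addr0 // => j ji.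
by rewrite mxE (negPf ji) andbF mul0r.
Qed.

Lemma innerC p q : inner p q = inner q p.
Proof. by apply: eq_bigr => i _; rewrite mulrC. Qed.

Lemma inner_deltar (i : 'I_d) p : inner p (delta_mx 0 i) = p 0 i.
Proof. by rewrite innerC inner_delta. Qed.

Lemma is_derive_inner (f g : V -> V) p v (df dg : V) :
  (forall i, is_derive p v (fun t => f t 0 i) (df 0 i)) ->
  (forall i, is_derive p v (fun t => g t 0 i) (dg 0 i)) ->
  is_derive p v (fun t => inner (f t) (g t)) (inner (f p) dg + inner (g p) df).
Proof.
move=> hf hg.
have -> : (fun t => inner (f t) (g t)) = \sum_(i < d) (fun t => f t 0 i * g t 0 i).
  by apply/funext => t; rewrite fct_sumE.
rewrite /inner -big_split /=; apply: is_derive_sum => i; exact: is_derive_mul.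
Qed.

Lemma is_derive_innerl q p v : is_derive p v (fun t => inner t q) (inner v q).
Proof.
have q' i : is_derive p v (fun=> q 0 i) ((0 : V) 0 i).
  by rewrite mxE; exact: is_derive_cst.
have /is_derive_eq := is_derive_inner (fun i => is_derive_coord i p v) q'; apply.
by rewrite innerC [X in X + _]big1 ?add0r => [|i _]; rewrite ?mxE ?mul0r // innerC.
Qed.

Lemma is_derive_sqnorm p v : is_derive p v (fun t => inner t t) (2 * inner p v).
Proof.
rewrite mulr2n mulrDl mul1r.
by apply: is_derive_inner => i; exact: is_derive_coord.
Qed.

(** The truncated exponents [a.-1] and [b.-1] do no harm at [0], where the coefficients [a%:R] and
    [b%:R] vanish. *)
Lemma is_derive_mono q a b p v :
  is_derive p v (fun t => inner t q ^+ a * inner t t ^+ b)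
   (a%:R * inner v q * (inner p q ^+ a.-1 * inner p p ^+ b) +
    2 * b%:R * inner p v * (inner p q ^+ a * inner p p ^+ b.-1)).
Proof.
have /is_derive_eq := is_derive_mul (is_derive_pow a (is_derive_innerl q p v))
  (is_derive_pow b (is_derive_sqnorm p v)).
by apply; ring.
Qed.

Lemma is_derive_mono2 q a b (i : 'I_d) p :
  is_derive p (delta_mx 0 i) ('D_(delta_mx 0 i) (fun t => inner t q ^+ a * inner t t ^+ b))
   (a%:R * a.-1%:R * (inner p q ^+ a.-2 * inner p p ^+ b) * q 0 i ^+ 2 +
    4 * a%:R * b%:R * (inner p q ^+ a.-1 * inner p p ^+ b.-1) * (p 0 i * q 0 i) +
    4 * b%:R * b.-1%:R * (inner p q ^+ a * inner p p ^+ b.-2) * p 0 i ^+ 2 +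
    2 * b%:R * (inner p q ^+ a * inner p p ^+ b.-1)).
Proof.
have -> : 'D_(delta_mx 0 i) (fun t => inner t q ^+ a * inner t t ^+ b) = fun t =>
  a%:R * q 0 i * (inner t q ^+ a.-1 * inner t t ^+ b) +
  2 * b%:R * (t 0 i * (inner t q ^+ a * inner t t ^+ b.-1)).
  apply/funext => t; have /@derive_val -> := is_derive_mono q a b t (delta_mx 0 i).
  by rewrite inner_delta inner_deltar; ring.
have /is_derive_eq := is_derive_add
  (is_derive_scale (a%:R * q 0 i) (is_derive_mono q a.-1 b p (delta_mx 0 i)))
  (is_derive_scale (2 * b%:R)
    (is_derive_mul (is_derive_coord i p _) (is_derive_mono q a b.-1 p _))).
by apply; rewrite inner_delta inner_deltar mxE !eqxx mulr1n mulr1; ring.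
Qed.

Lemma laplacian_mono q a b p :
  laplacian (fun t => inner t q ^+ a * inner t t ^+ b) p =
   (a * a.-1)%:R * inner p q ^+ a.-2 * inner p p ^+ b * inner q q +
   (2 * b)%:R * (2 * a%:R + 2 * b%:R - 2 + d%:R) * inner p q ^+ a * inner p p ^+ b.-1.
Proof.
rewrite /laplacian.
under eq_bigr => i _ do have /@derive_val -> := is_derive_mono2 q a b i p.
rewrite !big_split /= -!mulr_sumr sumr_const card_ord -[_ *+ d]mulr_natl -/(inner p q).
have -> : \sum_(i < d) q 0 i ^+ 2 = inner q q by [].
have -> : \sum_(i < d) p 0 i ^+ 2 = inner p p by [].
(* Summing over the axes has produced factors [<p, q>] and [|p|^2]; the small exponents are
   separated so that these factors can be absorbed into the truncated powers. *)
case: a b => [|a] [|[|b]] /=; rewrite ?exprS; ring.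
Qed.

Definition bimono a b c x y : R :=
  inner x y ^+ a * inner x x ^+ b * inner y y ^+ c.

(** The operator ['D] is additive only where the derivatives exist, so the linearity of [laplacian]
    rests on this condition. *)
Definition twice_derivable (f : V -> R) := forall (i : 'I_d) p,
  derivable f p (delta_mx 0 i) /\
  derivable ('D_(delta_mx 0 i) f) p (delta_mx 0 i).

Lemma twice_derivable_mono q a b :
  twice_derivable (fun t => inner t q ^+ a * inner t t ^+ b).
Proof.
move=> i p; split.
  by have /@ex_derive := is_derive_mono q a b p (delta_mx 0 i).
by have /@ex_derive := is_derive_mono2 q a b i p.
Qed.

Section Linearity.
Variables (f g : V -> R) (k : R).
Hypotheses (df : twice_derivable f) (dg : twice_derivable g).

Let deriveD2 (i : 'I_d) : 'D_(delta_mx 0 i) (f + g) =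
  'D_(delta_mx 0 i) f + 'D_(delta_mx 0 i) g.
Proof.
by apply/funext => p; rewrite deriveD //; [case: (df i p) | case: (dg i p)].
Qed.

Let deriveZ2 (i : 'I_d) : 'D_(delta_mx 0 i) (k \*: f) = k \*: 'D_(delta_mx 0 i) f.
Proof. by apply/funext => p; rewrite deriveZ //; case: (df i p). Qed.

Lemma twice_derivableD : twice_derivable (fun t => f t + g t).
Proof.
move=> i p; have [f1 f2] := df i p; have [g1 g2] := dg i p.
rewrite -[fun t => _]/(f + g) deriveD2.
by split; [exact: (derivableD f1 g1) | exact: (derivableD f2 g2)].
Qed.

Lemma twice_derivableZ : twice_derivable (fun t => k * f t).
Proof.
move=> i p; have [f1 f2] := df i p.
rewrite -[fun t => _]/(k \*: f) deriveZ2.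
by split; [exact: (derivableZ f1) | exact: (derivableZ f2)].
Qed.

Lemma laplacianD p : laplacian (fun t => f t + g t) p = laplacian f p + laplacian g p.
Proof.
rewrite -[LHS]/(laplacian (f + g) p) /laplacian -big_split.
apply: eq_bigr => i _ /=; have [_ f2] := df i p; have [_ g2] := dg i p.
by rewrite deriveD2 (deriveD f2 g2).
Qed.

Lemma laplacianZ p : laplacian (fun t => k * f t) p = k * laplacian f p.
Proof.
rewrite -[LHS]/(laplacian (k \*: f) p) /laplacian mulr_sumr.
apply: eq_bigr => i _ /=; have [_ f2] := df i p.
by rewrite deriveZ2 (deriveZ k f2).
Qed.

End Linearity.

(** The rotation invariant polynomials, presented inductively so that an identity between additive
    operators can be checked on scaled monomials. *)
Inductive invariant_poly : (V -> V -> R) -> Prop :=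
| invariant_mono k a b c : invariant_poly (fun x y => k * bimono a b c x y)
| invariant_add F G : invariant_poly F -> invariant_poly G ->
    invariant_poly (fun x y => F x y + G x y).

Lemma invariant_swap F : invariant_poly F -> invariant_poly (fun x y => F y x).
Proof.
elim=> [k a b c|G H _ hG _ hH]; last exact: invariant_add.
have -> : (fun x y => k * bimono a b c y x) = (fun x y => k * bimono a c b x y).
  by apply/funext => x; apply/funext => y; rewrite /bimono [inner y x]innerC mulrAC.
exact: invariant_mono.
Qed.

Lemma invariant_scale F k : invariant_poly F -> invariant_poly (fun x y => k * F x y).
Proof.
elim=> [l a b c|G H _ hG _ hH].
  under eq_fun do under eq_fun do rewrite mulrA.
  exact: invariant_mono.
under eq_fun do under eq_fun do rewrite mulrDr.
exact: invariant_add.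
Qed.

Lemma bimonoE y a b c : bimono a b c ^~ y =
  fun x => inner y y ^+ c * (inner x y ^+ a * inner x x ^+ b).
Proof. by apply/funext => x; rewrite mulrC. Qed.

Lemma twice_derivable_invariant F y : invariant_poly F -> twice_derivable (F ^~ y).
Proof.
elim=> [k a b c|G H _ hG _ hH]; last exact: twice_derivableD.
apply: (@twice_derivableZ (bimono a b c ^~ y)); rewrite bimonoE.
by apply: twice_derivableZ; exact: twice_derivable_mono.
Qed.

(* [Delta (|x|^(2b) h) = radial_coef a b |x|^(2b-2) h] for [h] harmonic and homogeneous
   of degree [a]. *)
Definition radial_coef a b : R := (2 * b)%:R * (2 * a%:R + 2 * b%:R - 2 + d%:R).

Lemma laplacian_x_mono k a b c :
  laplacian_x (fun x y => k * bimono a b c x y) =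
  fun x y => k * (a * a.-1)%:R * bimono a.-2 b c.+1 x y +
             k * radial_coef a b * bimono a b.-1 c x y.
Proof.
apply/funext => x; apply/funext => y; rewrite /laplacian_x.
have H := twice_derivable_mono y a b.
rewrite (@laplacianZ (bimono a b c ^~ y)) bimonoE; last exact: twice_derivableZ.
rewrite laplacianZ // laplacian_mono /bimono /radial_coef exprS.
by ring.
Qed.

Lemma laplacian_xD F G : invariant_poly F -> invariant_poly G ->
  laplacian_x (fun x y => F x y + G x y) =
  fun x y => laplacian_x F x y + laplacian_x G x y.
Proof.
move=> hF hG; apply/funext => x; apply/funext => y.
by apply: laplacianD; exact: twice_derivable_invariant.
Qed.

Lemma laplacian_xZ k F : invariant_poly F ->
  laplacian_x (fun x y => k * F x y) = fun x y => k * laplacian_x F x y.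
Proof.
move=> hF; apply/funext => x; apply/funext => y.
by apply: laplacianZ; exact: twice_derivable_invariant.
Qed.

(** Transfers every result on [laplacian_x] to [laplacian_y]. *)
Lemma laplacian_y_swap F :
  laplacian_y F = fun x y => laplacian_x (fun x y => F y x) y x.
Proof. by []. Qed.

Lemma laplacian_y_mono k a b c :
  laplacian_y (fun x y => k * bimono a b c x y) =
  fun x y => k * (a * a.-1)%:R * bimono a.-2 b.+1 c x y +
             k * radial_coef a c * bimono a b c.-1 x y.
Proof.
have S a' b' c' x y : bimono a' b' c' y x = bimono a' c' b' x y.
  by rewrite /bimono [inner y x]innerC mulrAC.
have E : (fun x y => k * bimono a b c y x) = fun x y => k * bimono a c b x y.
  by apply/funext => x; apply/funext => y; rewrite (S _ _ _ x y).
apply/funext => x; apply/funext => y.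
by rewrite laplacian_y_swap E laplacian_x_mono !(S _ _ _ x y).
Qed.

Lemma laplacian_yD F G : invariant_poly F -> invariant_poly G ->
  laplacian_y (fun x y => F x y + G x y) =
  fun x y => laplacian_y F x y + laplacian_y G x y.
Proof.
by move=> hF hG; rewrite !laplacian_y_swap laplacian_xD //; exact: invariant_swap.
Qed.

Lemma laplacian_yZ k F : invariant_poly F ->
  laplacian_y (fun x y => k * F x y) = fun x y => k * laplacian_y F x y.
Proof.
by move=> hF; rewrite !laplacian_y_swap laplacian_xZ //; exact: invariant_swap.
Qed.

Lemma invariant_laplacian_x F : invariant_poly F -> invariant_poly (laplacian_x F).
Proof.
elim=> [k a b c|G H hG iG hH iH]; last by rewrite laplacian_xD //; exact: invariant_add.
by rewrite laplacian_x_mono; apply: invariant_add; exact: invariant_mono.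
Qed.

Lemma invariant_laplacian_y F : invariant_poly F -> invariant_poly (laplacian_y F).
Proof.
move=> hF; rewrite laplacian_y_swap.
exact: (invariant_swap (invariant_laplacian_x (invariant_swap hF))).
Qed.

Definition additive_on_invariant (P : (V -> V -> R) -> V -> V -> R) :=
  forall F G, invariant_poly F -> invariant_poly G ->
  P (fun x y => F x y + G x y) = fun x y => P F x y + P G x y.

Lemma eq_on_invariant P Q :
  additive_on_invariant P -> additive_on_invariant Q ->
  (forall k a b c, P (fun x y => k * bimono a b c x y) =
                   Q (fun x y => k * bimono a b c x y)) ->
  forall F, invariant_poly F -> P F = Q F.
Proof.
move=> aP aQ PQ F; elim=> [|G H hG iG hH iH]; first exact: PQ.
by rewrite aP // aQ // iG iH.
Qed.

(** By additivity it is enough to compare monomials, where both sides expand explicitly; the final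
    case analysis isolates the exponents at which a predecessor is truncated. *)
Lemma laplacianC F : invariant_poly F ->
  laplacian_y (laplacian_x F) = laplacian_x (laplacian_y F).
Proof.
apply: (@eq_on_invariant (fun F => laplacian_y (laplacian_x F))
  (fun F => laplacian_x (laplacian_y F))) => [G H hG hH|G H hG hH|k a b c].
- rewrite (laplacian_xD hG hH).
  exact: (laplacian_yD (invariant_laplacian_x hG) (invariant_laplacian_x hH)).
- rewrite (laplacian_yD hG hH).
  exact: (laplacian_xD (invariant_laplacian_y hG) (invariant_laplacian_y hH)).
rewrite [in LHS]laplacian_x_mono [in RHS]laplacian_y_mono.
rewrite [LHS]laplacian_yD; try exact: invariant_mono.
rewrite [RHS]laplacian_xD; try exact: invariant_mono.
rewrite !laplacian_x_mono !laplacian_y_mono.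
apply/funext => x; apply/funext => y; rewrite /bimono /radial_coef.
case: a b c => [|[|a]] [|b] [|c] /=; rewrite ?exprS; ring.
Qed.

Lemma iter_laplacianC m F : invariant_poly F ->
  iter m (fun G => laplacian_y (laplacian_x G)) F =
  iter m (@laplacian_y R d) (iter m (@laplacian_x R d) F).
Proof.
exact: (iter_comp_commute invariant_laplacian_x invariant_laplacian_y laplacianC).
Qed.

Lemma invariant_sum n (F : 'I_n -> V -> V -> R) :
  (forall j, invariant_poly (F j)) -> invariant_poly (fun x y => \sum_(j < n) F j x y).
Proof.
elim: n F => [|n IHn] F hF.
  have -> : (fun x y => \sum_(j < 0) F j x y) = (fun x y => 0 * bimono 0 0 0 x y).
    by apply/funext => x; apply/funext => y; rewrite big_ord0 mul0r.
  exact: invariant_mono.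
under eq_fun do under eq_fun do rewrite big_ord_recl.
by apply: invariant_add => //; exact: IHn.
Qed.

Lemma laplacian_x_sum n (F : 'I_n -> V -> V -> R) :
  (forall j, invariant_poly (F j)) ->
  laplacian_x (fun x y => \sum_(j < n) F j x y) =
  fun x y => \sum_(j < n) laplacian_x (F j) x y.
Proof.
elim: n F => [|n IHn] F hF.
  have -> : (fun x y => \sum_(j < 0) F j x y) = (fun x y => 0 * bimono 0 0 0 x y).
    by apply/funext => x; apply/funext => y; rewrite big_ord0 mul0r.
  rewrite laplacian_x_mono; apply/funext => x; apply/funext => y.
  by rewrite big_ord0 !mul0r addr0.
under eq_fun do under eq_fun do rewrite big_ord_recl.
rewrite laplacian_xD //; last exact: invariant_sum.
by rewrite IHn //; apply/funext => x; apply/funext => y; rewrite big_ord_recl.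
Qed.

Lemma laplacian_y_sum n (F : 'I_n -> V -> V -> R) :
  (forall j, invariant_poly (F j)) ->
  laplacian_y (fun x y => \sum_(j < n) F j x y) =
  fun x y => \sum_(j < n) laplacian_y (F j) x y.
Proof.
move=> hF; rewrite laplacian_y_swap laplacian_x_sum // => j.
exact: invariant_swap (hF j).
Qed.

End Laplacian.

(** * Homogenized Gegenbauer and Chebyshev polynomials *)

Section GegenbauerForm.
Variable R : realType.

(* [(p-1)!] times the coefficient of [s^(k-2j) N^j] in [N^(k/2) C_k^p(s / N^(1/2))];
   for [p = 0] and [k > 0] it is [2 / k] times the one of [T_k], so that the two
   families are treated uniformly. *)
Definition gegen_coef p k j : R :=
  if (2 * j <= k)%N then
    (-1) ^+ j * 2 ^+ (k - 2 * j) * ((k - j + p).-1)`!%:R /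
      (j`!%:R * (k - 2 * j)`!%:R)
  else 0.

Lemma gegen_coef_gt p k j : (k < 2 * j)%N -> gegen_coef p k j = 0.
Proof. by rewrite /gegen_coef ltnNge; case: (2 * j <= k)%N. Qed.

Lemma factR_neq0 n : n`!%:R != 0 :> R.
Proof. by rewrite pnatr_eq0 -lt0n fact_gt0. Qed.

(** Writing [k = a + 2j] removes the test and the truncated subtractions, so that [field] can
    compare coefficients. *)
Lemma gegen_coef_add p a j : gegen_coef p (a + 2 * j) j =
  (-1) ^+ j * 2 ^+ a * ((a + j + p).-1)`!%:R / (j`!%:R * a`!%:R).
Proof.
rewrite /gegen_coef leq_addl addnK.
by have -> : (a + 2 * j - j = a + j)%N by lia.
Qed.

(** Two monomials contribute to the same monomial of the Laplacian: the [j]-th one through the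
    second derivative in [s], the next one through its radial factor. With [a = k - 2j - 2], their
    ratio leaves [(a + j + p + 1) - (a + j + m + 1) = p - m]; this vanishes at [p = m], which is the
    harmonic case. *)
Lemma gegen_coefS d m p k j : d = (2 * m + 2)%N ->
  gegen_coef p k j * ((k - 2 * j) * (k - 2 * j).-1)%:R +
  gegen_coef p k j.+1 * radial_coef R d (k - 2 * j.+1) j.+1 =
  if (2 * j.+1 <= k)%N then 4 * (p%:R - m%:R) * gegen_coef p.+1 (k - 2) j else 0.
Proof.
move=> ->; case: (leqP (2 * j.+1) k) => [le_jk | lt_kj]; last first.
  (* The exponent [k - 2j] of [s] is now at most [1], so the second derivative in [s] is zero. *)
  rewrite (gegen_coef_gt _ lt_kj) mul0r addr0.
  have [le_jk|lt_kj'] := leqP (2 * j) k; last by rewrite gegen_coef_gt ?mul0r.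
  have : (k - 2 * j <= 1)%N by lia.
  by case: (k - 2 * j)%N => [|[|//]] _; rewrite mulr0.
have [a ->] : exists a, k = (a + 2 * j.+1)%N by exists (k - 2 * j.+1)%N; lia.
rewrite gegen_coef_add.
have -> : (a + 2 * j.+1 = a.+2 + 2 * j)%N by lia.
rewrite gegen_coef_add.
have -> : (a.+2 + 2 * j - 2 = a + 2 * j)%N by lia.
rewrite gegen_coef_add addnK.
have -> : (a.+2 + 2 * j - 2 * j.+1 = a)%N by lia.
have -> : ((a.+2 + j + p).-1 = (a + j + p).+1)%N by lia.
have -> : ((a + j.+1 + p).-1 = a + j + p)%N by lia.
have -> : ((a + j + p.+1).-1 = a + j + p)%N by lia.
rewrite /radial_coef !factS /= !exprS !natrM !natrD -!natr1.
field.
by rewrite !natr1 !pnatr_eq0 -!lt0n !fact_gt0.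
Qed.

(** The two sums align after a shift by one. The unmatched end terms vanish: [k - 2 * k] is
    truncated to [0], and the radial coefficient is [0] at [j = 0]. The sequence [M] stands for
    monomials in either variable. *)
Lemma gegen_coef_sum d m p k (M : nat -> R) : d = (2 * m + 2)%N ->
  \sum_(j < k.+1) (gegen_coef p k j * ((k - 2 * j) * (k - 2 * j).-1)%:R * M j.+1 +
    gegen_coef p k j * radial_coef R d (k - 2 * j) j * M j) =
  \sum_(j < k) (if (2 * j.+1 <= k)%N
    then 4 * (p%:R - m%:R) * gegen_coef p.+1 (k - 2) j else 0) * M j.+1.
Proof.
move=> hd; rewrite big_split /= [X in X + _]big_ord_recr [X in _ + X]big_ord_recl /=.
have -> : (k - 2 * k = 0)%N by lia.
rewrite /radial_coef !(muln0, mulr0, mul0r, mul0n) addr0 add0r -big_split /=.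
apply: eq_bigr => j _; rewrite -(gegen_coefS _ _ _ hd) /radial_coef /bump /= add1n.
by rewrite [RHS]mulrDl.
Qed.

Section Form.
Variables (d m : nat) (hd : d = (2 * m + 2)%N).
Local Notation V := 'rV[R]_d.

(** For [p > 0] this is [(p-1)! |y|^(2e)] times the homogenized [C_k^p]; [e] counts the factors
    [|y|^2] released by [laplacian_x]. *)
Definition gegen p k e (x y : V) : R :=
  \sum_(j < k.+1) gegen_coef p k j * bimono (k - 2 * j) j (j + e) x y.

Lemma invariant_gegen p k e : invariant_poly (gegen p k e).
Proof. by apply: invariant_sum => j; exact: invariant_mono. Qed.

Lemma laplacian_x_gegen p k e : laplacian_x (gegen p k.+2 e) =
  fun x y => 4 * (p%:R - m%:R) * gegen p.+1 k e.+1 x y.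
Proof.
rewrite laplacian_x_sum => [|j]; last exact: invariant_mono.
apply/funext => x; apply/funext => y.
(* From the [j]-th monomial, the radial part leaves [M j] and the second derivative in [s] leaves
   [M j.+1]. *)
pose M j := bimono (k.+2 - 2 * j) j.-1 (j + e) x y.
transitivity (\sum_(j < k.+3)
    (gegen_coef p k.+2 j * ((k.+2 - 2 * j) * (k.+2 - 2 * j).-1)%:R * M j.+1 +
     gegen_coef p k.+2 j * radial_coef R d (k.+2 - 2 * j) j * M j)).
  apply: eq_bigr => j _; rewrite laplacian_x_mono /M /=.
  by have -> : ((k.+2 - 2 * j).-2 = k.+2 - 2 * j.+1)%N by lia.
rewrite (gegen_coef_sum _ _ _ hd) big_ord_recr /= ifF ?mul0r ?addr0; last by apply/negbTE; lia.
rewrite mulr_sumr; apply: eq_bigr => j _.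
rewrite /M subn2 /= addSnnS.
have -> : (k.+2 - 2 * j.+1 = k - 2 * j)%N by lia.
case: ifPn => [_|hj]; first by rewrite !mulrA.
by rewrite gegen_coef_gt ?mul0r ?mulr0 //; lia.
Qed.

(** At [p = m] the form without its factor [|y|^(2e+2)] is harmonic in [y] of degree [k], so only
    the radial factor of [|y|^(2e+2)] survives. *)
Lemma laplacian_y_gegen k e : laplacian_y (gegen m k e.+1) =
  fun x y => 4 * e.+1%:R * (k + e + m).+1%:R * gegen m k e x y.
Proof.
rewrite laplacian_y_sum => [|j]; last exact: invariant_mono.
apply/funext => x; apply/funext => y.
pose M j := bimono (k - 2 * j) j (j + e) x y.
transitivity (\sum_(j < k.+1)
    (gegen_coef m k j * ((k - 2 * j) * (k - 2 * j).-1)%:R * M j.+1 +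
     gegen_coef m k j * radial_coef R d (k - 2 * j) j * M j) +
    \sum_(j < k.+1) 4 * e.+1%:R * (k + e + m).+1%:R * (gegen_coef m k j * M j)).
  rewrite -big_split; apply: eq_bigr => j _ /=; rewrite laplacian_y_mono /M /= addnS.
  have -> : ((k - 2 * j).-2 = k - 2 * j.+1)%N by lia.
  have [le_jk|lt_kj] := leqP (2 * j) k; last by rewrite gegen_coef_gt //; ring.
  have kR : k%:R = (k - 2 * j)%:R + 2 * j%:R :> R by rewrite -natrM -natrD subnK.
  (* The increment does not depend on [j]: it is the eigenvalue, and the remaining sum is the
     Laplacian of a harmonic form. *)
  have -> : radial_coef R d (k - 2 * j) (j + e).+1 =
      radial_coef R d (k - 2 * j) j + 4 * e.+1%:R * (k + e + m).+1%:R.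
    rewrite /radial_coef hd !natrM -!natr1 !natrD kR.
    by ring.
  by rewrite addSn /=; ring.
rewrite (gegen_coef_sum _ _ _ hd) big1 ?add0r => [|j _].
  by rewrite -mulr_sumr.
by rewrite subrr mulr0 mul0r if_same mul0r.
Qed.

(** The constant is the product of the factors [4 (p - m)] for [p < i]. *)
Lemma iter_laplacian_x_gegen i k c : (i <= m)%N ->
  iter i (@laplacian_x R d) (fun x y => c * gegen 0 (k + 2 * i) 0 x y) =
  fun x y => c * ((- 4) ^+ i * (m`!%:R / (m - i)`!%:R)) * gegen i k i x y.
Proof.
elim: i k => [|i IHi] k lt_im.
  rewrite muln0 addn0 subn0 divff ?factR_neq0 //=.
  by apply/funext => x; apply/funext => y; rewrite !mulr1.
have -> : (k + 2 * i.+1 = k.+2 + 2 * i)%N by lia.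
rewrite iterS IHi 1?ltnW // laplacian_xZ; last exact: invariant_gegen.
rewrite laplacian_x_gegen; apply/funext => x; apply/funext => y.
have -> : (m - i = (m - i.+1).+1)%N by lia.
have -> : m%:R = i%:R + (m - i.+1)%:R + 1 :> R.
  by rewrite -natrD natr1; congr (_%:R); lia.
rewrite factS exprS natrM -natr1; field.
by rewrite addrC natr1 !pnatr_eq0 -!lt0n fact_gt0.
Qed.

Lemma iter_laplacian_y_gegen i k c :
  iter i (@laplacian_y R d) (fun x y => c * gegen m k i x y) =
  fun x y => c * (4 ^+ i * i`!%:R * ((k + m + i)`!%:R / (k + m)`!%:R)) * gegen m k 0 x y.
Proof.
elim: i c => [|i IHi] c.
  by rewrite addn0 divff ?factR_neq0 //=; apply/funext => x;
    apply/funext => y; rewrite !mulr1.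
(* The innermost Laplacian is applied first, and its factor is absorbed into the constant [c] of the
   induction hypothesis. *)
rewrite iterSr laplacian_yZ; last exact: invariant_gegen.
rewrite laplacian_y_gegen.
have -> : (fun x y => c * (4 * i.+1%:R * (k + i + m).+1%:R * gegen m k i x y)) =
    (fun x y => (c * (4 * i.+1%:R * (k + i + m).+1%:R)) * gegen m k i x y).
  by apply/funext => x; apply/funext => y; rewrite mulrA.
rewrite IHi; apply/funext => x; apply/funext => y; congr (_ * _).
rewrite addnS !factS exprS !natrM [(k + i + m)%N]addnAC; field.
exact: factR_neq0.
Qed.

Lemma iter_laplacian_gegen k c :
  iter m (fun F => laplacian_y (laplacian_x F))
    (fun x y => c * gegen 0 (k + 2 * m) 0 x y) =
  fun x y => c * ((- 16) ^+ m * m`!%:R ^+ 2 * ((k + 2 * m)`!%:R / (k + m)`!%:R)) *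
    gegen m k 0 x y.
Proof.
rewrite (iter_laplacianC _ (invariant_scale _ (invariant_gegen _ _ _))).
have /(congr1 (iter m (@laplacian_y R d))) -> :=
  iter_laplacian_x_gegen k c (leqnn m).
rewrite iter_laplacian_y_gegen; apply/funext => x; apply/funext => y; congr (_ * _).
have -> : (k + m + m = k + 2 * m)%N by lia.
have -> : - 16 = (- 4) * 4 :> R by ring.
rewrite subnn fact0 exprMn; field.
exact: factR_neq0.
Qed.

End Form.
End GegenbauerForm.

(** * Chebyshev polynomials as real parts of powers *)

Section Chebyshev.
Variables (R : realType) (n : nat).
Implicit Types x y : 'rV[R]_n.+1.

(** For [k > 0], the coefficient of [s^(k-2j) N^j] in [N^(k/2) T_k(s / N^(1/2))]. At [k = 0] it is
    [0], although [T_0 = 1], so the lemmas below start at degree [1]. *)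
Definition cheb_coef k j : R := k%:R / 2 * gegen_coef R 0 k j.

Lemma cheb_coef_gt k j : (k < 2 * j)%N -> cheb_coef k j = 0.
Proof. by move=> lt_kj; rewrite /cheb_coef gegen_coef_gt ?mulr0. Qed.

Lemma cheb_coef0 k : cheb_coef k.+1 0 = 2 ^+ k.
Proof.
rewrite /cheb_coef /gegen_coef muln0 leq0n !subn0 addn0 /= factS fact0 expr0 exprS natrM.
by field; rewrite factR_neq0 addrC natr1 pnatr_eq0.
Qed.

Lemma cheb_coefS k j :
  cheb_coef k.+3 j.+1 = 2 * cheb_coef k.+2 j.+1 - cheb_coef k.+1 j.
Proof.
rewrite /cheb_coef; case: (ltngtP (2 * j) k.+1) => [lt_jk|lt_kj|eq_jk].
- have [a kE] : exists a, k = (a + 2 * j)%N by exists (k - 2 * j)%N; lia.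
  have -> : (k.+3 = a.+1 + 2 * j.+1)%N by lia.
  have -> : (k.+2 = a + 2 * j.+1)%N by lia.
  have -> : (k.+1 = a.+1 + 2 * j)%N by lia.
  rewrite !gegen_coef_add.
  have -> : ((a.+1 + j.+1 + 0).-1 = (a + j).+1)%N by lia.
  have -> : ((a + j.+1 + 0).-1 = a + j)%N by lia.
  have -> : ((a.+1 + j + 0).-1 = a + j)%N by lia.
  rewrite !factS !exprS !natrM !natrD !natrM -!natr1 !natrD.
  field.
  by rewrite !natr1 !pnatr_eq0 -!lt0n !fact_gt0.
- by rewrite !gegen_coef_gt ?mulr0 ?subrr //; lia.
(* On the left stands the coefficient of a pure power of [N]; the form of degree [k + 2] does not
   contribute to it. *)
- rewrite [gegen_coef R 0 k.+2 _]gegen_coef_gt; last by lia.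
  case: j eq_jk => [//|j] eq_jk.
  have -> : (k.+3 = 0 + 2 * j.+2)%N by lia.
  have -> : (k.+1 = 0 + 2 * j.+1)%N by lia.
  rewrite !gegen_coef_add !add0n !addn0 /= !factS !exprS !natrM -!natr1.
  field.
  by rewrite !natr1 !pnatr_eq0 -!lt0n !fact_gt0.
Qed.

Definition cheb k x y : R := \sum_(j < k.+1) cheb_coef k j * bimono (k - 2 * j) j j x y.

Lemma chebSS k x y : cheb k.+3 x y =
  2 * inner x y * cheb k.+2 x y - inner x x * inner y y * cheb k.+1 x y.
Proof.
pose M j := bimono (k.+3 - 2 * j) j j x y.
(* The leading terms agree on both sides and are split off; the others are matched by
   [cheb_coefS]. *)
have -> : cheb k.+3 x y = 2 ^+ k.+2 * M 0%N +
    \sum_(j < k.+3) cheb_coef k.+3 j.+1 * M j.+1.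
  by rewrite /cheb big_ord_recl cheb_coef0.
have -> : 2 * inner x y * cheb k.+2 x y = 2 ^+ k.+2 * M 0%N +
    \sum_(j < k.+3) 2 * cheb_coef k.+2 j.+1 * M j.+1.
  transitivity (\sum_(j < k.+4) 2 * cheb_coef k.+2 j * M j).
    rewrite big_ord_recr /= cheb_coef_gt; last by lia.
    rewrite !(mulr0, mul0r) addr0 /cheb mulr_sumr; apply: eq_bigr => j _.
    (* Multiplication by [s] raises the exponent [k + 2 - 2j] only if the subtraction is not
       truncated; otherwise the coefficient is [0]. *)
    have [le_jk|lt_kj] := leqP (2 * j) k.+2; last first.
      by rewrite cheb_coef_gt // !(mulr0, mul0r).
    rewrite /M /bimono; have -> : (k.+3 - 2 * j = (k.+2 - 2 * j).+1)%N by lia.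
    by rewrite exprS; ring.
  by rewrite big_ord_recl cheb_coef0 -exprS.
have -> : inner x x * inner y y * cheb k.+1 x y =
    \sum_(j < k.+3) cheb_coef k.+1 j * M j.+1.
  rewrite big_ord_recr /= cheb_coef_gt; last by lia.
  rewrite !(mulr0, mul0r) addr0 /cheb mulr_sumr; apply: eq_bigr => j _.
  rewrite /M /bimono.
  have -> : (k.+3 - 2 * j.+1 = k.+1 - 2 * j)%N by lia.
  by rewrite !exprS; ring.
rewrite -addrA -sumrB; congr (_ + _); apply: eq_bigr => j _.
by rewrite cheb_coefS mulrBl.
Qed.

Lemma creal_paravector_exp k x y :
  creal ((paravector x * paravector_conj y) ^+ k.+1) = cheb k.+1 x y.
Proof.
(* The recurrence has order two, so the induction carries two consecutive exponents, starting from
   [1] and [2]. *)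
suff [] : creal ((paravector x * paravector_conj y) ^+ k.+1) = cheb k.+1 x y /\
    creal ((paravector x * paravector_conj y) ^+ k.+2) = cheb k.+2 x y by [].
elim: k => [|k [IHk IHk1]]; last first.
  by split=> //; rewrite creal_paravectorS chebSS IHk IHk1.
have c1 : cheb 1 x y = inner x y.
  rewrite /cheb !big_ord_recl big_ord0 /= cheb_coef0 /cheb_coef gegen_coef_gt //.
  by rewrite /bimono /=; ring.
have c2 : cheb 2 x y = 2 * inner x y ^+ 2 - inner x x * inner y y.
  rewrite /cheb !big_ord_recl big_ord0 /= cheb_coef0 /cheb_coef /gegen_coef /bimono /=.
  rewrite -[bump 0 0]/1%N -[(2 - 2 * 0)%N]/2%N -[(2 - 2 * 1)%N]/0%N addn0 fact0.
  rewrite (mulr0 (2 / 2)) mul0r addr0 addr0 -[(1)`!]/1%N.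
  by field.
rewrite creal_paravectorS c2 !expr1 expr0 creal_paravector1 creal1 c1.
by split=> //; ring.
Qed.

Lemma chebE k x y : cheb k x y = k%:R / 2 * gegen 0 k 0 x y.
Proof.
rewrite /gegen mulr_sumr; apply: eq_bigr => j _.
by rewrite addn0 [RHS]mulrA.
Qed.

(** * Comparison with polynomials in the cosine *)

Lemma inner_ge0 x : 0 <= inner x x.
Proof. by apply: sumr_ge0 => i _; rewrite -expr2 sqr_ge0. Qed.

Lemma enorm_sqr x : enorm x ^+ 2 = inner x x.
Proof. by rewrite sqr_sqrtr // inner_ge0. Qed.

Lemma enorm_eq0 x : enorm x = 0 -> x = 0.
Proof.
move=> x0; have := enorm_sqr x; rewrite x0 expr0n /= => /esym/eqP.
rewrite psumr_eq0 => [/allP xx0|i _]; last by rewrite -expr2 sqr_ge0.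
apply/matrixP => i j; rewrite mxE ord1.
by have := xx0 j (mem_index_enum j); rewrite /= mulf_eq0 orbb => /eqP.
Qed.

(** If a norm vanishes then so does the vector, and both sides are [0]; hence the homogenizations
    below hold for all [x] and [y]. *)
Lemma cosineM x y : inner x y / (enorm x * enorm y) * (enorm x * enorm y) = inner x y.
Proof.
have [/eqP|] := eqVneq (enorm x * enorm y) 0; last by move=> ?; rewrite divfK.
rewrite mulf_eq0 => /orP[] /eqP/enorm_eq0 ->.
  by rewrite /inner !big1 ?mul0r // => i _; rewrite mxE mul0r.
by rewrite [in X in X = _]/inner [RHS]/inner !big1 ?mul0r // => i _; rewrite mxE mulr0.
Qed.

Lemma homogenized_power x y k j (r := enorm x * enorm y) : (2 * j <= k)%N ->
  (inner x y / r) ^+ (k - 2 * j) * r ^+ k = bimono (k - 2 * j) j j x y.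
Proof.
move=> le_jk; rewrite -[in X in _ * r ^+ X](subnK le_jk) exprD mulrA -exprMn cosineM.
by rewrite exprM /r [(_ * _) ^+ 2]exprMn !enorm_sqr exprMn mulrA.
Qed.

Lemma chebyshevT_exp k x y (r := enorm x * enorm y) :
  (chebyshevT R k).[inner x y / r] * r ^+ k =
  creal ((paravector x * paravector_conj y) ^+ k).
Proof.
suff [] : (chebyshevT R k).[inner x y / r] * r ^+ k =
    creal ((paravector x * paravector_conj y) ^+ k) /\
  (chebyshevT R k.+1).[inner x y / r] * r ^+ k.+1 =
    creal ((paravector x * paravector_conj y) ^+ k.+1) by [].
elim: k => [|k [IHk IHk1]].
  rewrite expr0 expr1 creal1 creal_paravector1 /= hornerC hornerX mulr1.
  by split=> //; exact: cosineM.
split=> //; rewrite creal_paravectorS -IHk -IHk1.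
rewrite -[chebyshevT R k.+2]/(2 *: 'X * chebyshevT R k.+1 - chebyshevT R k).
rewrite hornerD hornerN hornerM hornerZ hornerX -!enorm_sqr.
have := cosineM x y; rewrite -/r; set w := _ / r => <-.
by rewrite !exprS /r; ring.
Qed.

(** The factor [1 / m!] comes from [Gamma (m+1)] in the denominator of the Gegenbauer
    coefficients. *)
Lemma gegenbauer_gegen m k x y (r := enorm x * enorm y) :
  gegenbauer k m.+1%:R (inner x y / r) * r ^+ k = (m`!%:R)^-1 * gegen m.+1 k 0 x y.
Proof.
rewrite /gegenbauer /gegen mulr_suml mulr_sumr.
(* The Gegenbauer sum stops at [k./2]; the additional terms of [gegen] have zero coefficients. *)
rewrite (big_ord_widen k.+1 (fun j => (-1) ^+ j *
  (Gamma ((k - j)%:R + m.+1%:R) / (Gamma m.+1%:R * j`!%:R * (k - 2 * j)`!%:R)) *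
  (2 * (inner x y / r)) ^+ (k - 2 * j) * r ^+ k)); last by lia.
rewrite big_mkcond; apply: eq_bigr => j _ /=.
have [lt_jk|le_kj] := ltnP j k./2.+1; last first.
  by rewrite gegen_coef_gt ?mul0r ?mulr0 //; lia.
have le_jk : (2 * j <= k)%N by lia.
rewrite -natrD addnS !GammaS exprMn addn0 -homogenized_power //.
rewrite /gegen_coef le_jk addnS /=.
by field; rewrite !pnatr_eq0 -!lt0n !fact_gt0.
Qed.

End Chebyshev.

Theorem theorem4p5 (R : realType) (m n k : nat) (hn : n = (2 * m + 1)%N)
    (hkm : (1 <= k + m)%N) (x y : 'rV[R]_n.+1) :
  iter m (fun F => laplacian_y (laplacian_x F))
    (fun x' y' : 'rV[R]_n.+1 =>
       creal ((paravector x' * paravector_conj y') ^+ (k + 2 * m))) x y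
  = 1 / 2 * betahat R m k * zonal m k x y.
Proof.
have hd : n.+1 = (2 * m + 2)%N by lia.
rewrite /zonal /betahat; case: eqVneq hkm hd => [->|m0] hkm hd.
  (* For [m = 0] no Laplacian is applied and the constant is [1], by cancelling [k], which is
     nonzero by [hkm]. *)
  rewrite muln0 !addn0 /= in hkm *.
  rewrite -chebyshevT_exp -[1]/(0.+1%:R) !addn1 !GammaS fact0 !expr0 expr1n.
  by field; rewrite factR_neq0 pnatr_eq0 -lt0n.
case: m m0 hn hkm hd => [//|m] _ hn hkm hd.
have -> : (fun x' y' : 'rV[R]_n.+1 =>
    creal ((paravector x' * paravector_conj y') ^+ (k + 2 * m.+1))) =
    fun x' y' => (k + 2 * m.+1)%:R / 2 * gegen 0 (k + 2 * m.+1) 0 x' y'.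
  apply/funext => x'; apply/funext => y'; rewrite -chebE.
  have -> : (k + 2 * m.+1 = (k + 2 * m).+2)%N by lia.
  exact: creal_paravector_exp.
rewrite (iter_laplacian_gegen hd) -!mulrA [gegenbauer _ _ _ * _]gegenbauer_gegen.
have -> : (- 16 : R) ^+ m.+1 = (- 1) ^+ m.+1 * 4 ^+ (2 * m.+1).
  by rewrite exprM -exprMn; congr (_ ^+ _); ring.
(* One factor [m!] of the cube in [betahat] cancels against [m] and the [(m-1)!] of the
   normalization of [gegen], where the mathematical [m] is [m.+1] here. *)
rewrite !addn1 !GammaS !addnS /= [m.+1`!]factS natrM.
by field; rewrite !factR_neq0 -natrD ![1 + _]addrC !natr1 !pnatr_eq0.
Qed.
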